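(* Let $n \ge 1$ and let $\Pi_n$ be a partially exchangeable random partition of $[n]=\{1,2,\ldots,n\}$. Then the distribution of its increments $(X_1,\ldots,X_n)$ uniquely determines the distribution of $\Pi_n$. That is, if $\Pi_n$ and $\Pi_n'$ are two partially exchangeable random partitions of $[n]$ whose increment sequences have the same distribution on $\{0,1\}^n$, then $\Pi_n$ and $\Pi_n'$ have the same distribution.
   Context: A random partition of $[n]=\{1,\ldots,n\}$ is a random variable with values in the finite set of set partitions of $[n]$. The blocks $A_1,\ldots,A_k$ of a partition are always listed in order of appearance, i.e. in increasing order of their smallest elements. A composition of $n$ is an ordered tuple of positive integers summing to $n$. A random partition $\Pi_n$ of $[n]$ is called partially exchangeable if there is a function $p$ on the set of compositions of $n$ such that, for every partition $\{A_1,\ldots,A_k\}$ of $[n]$ with blocks listed in order of appearance, $P(\Pi_n=\{A_1,\ldots,A_k\})=p(|A_1|,\ldots,|A_k|)$. The increments of a partition of $[n]$ are the sequence $(X_1,\ldots,X_n)$ where $X_i=1$ if $i$ is the smallest element of the block containing it, and $X_i=0$ otherwise (so $X_1=1$ always). *)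

(* Defs.v *)
From HB Require Import structures.
From mathcomp Require Import all_boot all_order all_algebra.
From mathcomp Require Import all_classical all_reals all_analysis.

Set Implicit Arguments.
Unset Strict Implicit.
Unset Printing Implicit Defensive.

(* The ground set [n] = {1, ..., n} is represented by 'I_n = {0, ..., n - 1},
   the ordinal i standing for the integer i + 1. *)

Record set_partition (n : nat) : Type := SetPartition {
  block_set :> {set {set 'I_n}};
  _ : finset.partition block_set [set: 'I_n]%SET
}.

HB.instance Definition _ (n : nat) := [isSub for @block_set n].
HB.instance Definition _ (n : nat) := [Finite of set_partition n by <:].

Section Blocks.
Variable n : nat.

(* n if A is empty, which never happens for a block *)
Definition block_min (A : {set 'I_n}) : nat := \big[minn/n]_(i in A) (i : nat).

Definition blocks (B : set_partition n) : seq {set 'I_n} :=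
  sort (fun A C => (block_min A <= block_min C)%N) (enum (block_set B)).

Definition is_composition (s : seq nat) : bool :=
  all (fun m => (0 < m)%N) s && (sumn s == n).

Definition composition : Type := {s : seq nat | is_composition s}.

Lemma block_sizes_subproof (B : set_partition n) :
  is_composition [seq #|A| | A : {set 'I_n} <- blocks B].
Proof.
case: B => B Bpart; rewrite /is_composition /blocks /=.
have [_ _ B0] := and3P Bpart.
apply/andP; split.
  rewrite all_map all_sort; apply/allP => A; rewrite mem_enum => AB /=.
  rewrite card_gt0; apply: contraNneq B0 => <-; exact: AB.
rewrite sumnE big_map (perm_big (enum B)) ?perm_sort//=.
by rewrite big_enum /= -(card_partition Bpart) cardsT card_ord.
Qed.

Definition block_sizes (B : set_partition n) : composition :=
  exist is_composition [seq #|A| | A : {set 'I_n} <- blocks B] (block_sizes_subproof B).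

Definition increments (B : set_partition n) : n.-tuple bool :=
  [tuple (i : nat) == block_min (finset.pblock B i) | i < n].

Lemma point_subproof :
  finset.partition (preim_partition (fun=> tt) [set: 'I_n]%SET) [set: 'I_n]%SET.
Proof. exact: preim_partitionP. Qed.

HB.instance Definition _ := isPointed.Build (set_partition n)
  (SetPartition point_subproof).

HB.instance Definition _ := @isMeasurable.Build default_measure_display
  (set_partition n) discrete_measurable discrete_measurable0
  discrete_measurableC discrete_measurableU.

Lemma measurable_increments :
  measurable_fun [set: set_partition n]%classic increments.
Proof. by []. Qed.

HB.instance Definition _ :=
  isMeasurableFun.Build _ _ (set_partition n) (n.-tuple bool) increments
    measurable_increments.

End Blocks.

Definition partially_exchangeable (n : nat) (d : measure_display)
    (T : measurableType d) (R : realType) (P : probability T R)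
    (Pi : {RV P >-> set_partition n}) : Prop :=
  exists p : composition n -> R, forall B : set_partition n,
    P (Pi @^-1` [set B])%classic = (p (block_sizes B))%:E.

Definition same_distribution (d1 d2 d : measure_display)
    (T1 : measurableType d1) (T2 : measurableType d2) (S : measurableType d)
    (R : realType) (P1 : probability T1 R) (P2 : probability T2 R)
    (X1 : {RV P1 >-> S}) (X2 : {RV P2 >-> S}) : Prop :=
  forall A : set S, measurable A -> distribution P1 X1 A = distribution P2 X2 A.

(* Main.v *)
Require Import Defs.
From HB Require Import structures.
From mathcomp Require Import all_boot all_order all_algebra.
From mathcomp Require Import all_fingroup.
From mathcomp Require Import all_classical all_reals all_analysis.

Import Order.TTheory GRing.Theory.

Set Implicit Arguments.
Unset Strict Implicit.
Unset Printing Implicit Defensive.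

(** For each binary sequence x, the probability that the increments equal x is
    the sum of p (block sizes of B) over the partitions B with increments x.
    This is a linear system for the values of p, and the proof shows that it is
    triangular, with nonzero diagonal, for the order by weight below.

    Number the blocks 0, 1, 2, ... in order of appearance and let the weight of
    a partition be the sum, over the elements of the ground set, of the number
    of the block containing them. Permuting the elements changes neither the
    block sizes nor the weight, as long as the order of appearance is kept; in
    particular every B can be relabelled into a partition C into successive
    intervals, with the same sizes and the same weight ([block_sizes_relabel],
    [weight_relabel], [relabel_monotone]).

    Among all the partitions with the increments of an interval partition C,
    the heaviest is C, and it is the only one of its weight
    ([weight_lt_monotone]): the increments fix the position of the first
    element of each block, and an element of C lies in the last block opened
    so far, which is the largest number it could have. So if the difference q
    of two functions p solves the homogeneous system, the equation for the
    increments of C expresses q (sizes of C) through values of q at partitions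
    of smaller weight, and q vanishes by induction on the weight
    ([block_sizes_sum_inj]). *)

Local Notation pblock := finset.pblock.

(** * Blocks in order of appearance *)

Section BlockOrder.
Variable n : nat.
Implicit Types (A : {set 'I_n}) (B C : set_partition n) (i j m : 'I_n).

Lemma block_min_attained A i : i \in A ->
  exists2 m, m \in A & block_min A = m.
Proof.
move=> iA; rewrite /block_min.
have [//|m mA ->] := @eq_bigmin _ nat _ n i (mem A) (fun j => nat_of_ord j) iA.
  by move=> j _; exact: ltnW.
by exists m.
Qed.

Lemma block_min_le A i : i \in A -> block_min A <= i.
Proof. exact: (@bigmin_le_cond _ nat _ n i (mem A) (fun j => nat_of_ord j)). Qed.

Lemma mem_blocks B A : (A \in blocks B) = (A \in block_set B).
Proof. by rewrite mem_sort mem_enum. Qed.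

Lemma blocks_uniq B : uniq (blocks B).
Proof. by rewrite sort_uniq enum_uniq. Qed.

Lemma block_cover B i : i \in finset.cover B.
Proof. by case: B => B BP; rewrite (cover_partition BP) finset.in_setT. Qed.

Lemma block_triv B : finset.trivIset B.
Proof. by case: B => B BP; exact: partition_trivIset BP. Qed.

Lemma pblock_blocks B i : pblock B i \in blocks B.
Proof. by rewrite mem_blocks pblock_mem// block_cover. Qed.

Lemma mem_own_block B i : i \in pblock B i.
Proof. by rewrite mem_pblock block_cover. Qed.

Lemma pblock_block B A i : A \in block_set B -> i \in A -> pblock B i = A.
Proof. by move=> AB iA; apply: def_pblock => //; exact: block_triv. Qed.

Lemma block_inhabited B A : A \in block_set B -> exists i, i \in A.
Proof.
case: B => B BP /= AB; apply/finset.set0Pn.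
exact: (partition_neq0 BP).
Qed.

Lemma block_min_inj B : {in block_set B &, injective (@block_min n)}.
Proof.
move=> A A' AB A'B eqm.
have [i iA] := block_inhabited AB; have [i' iA'] := block_inhabited A'B.
have [m mA Em] := block_min_attained iA.
have [m' mA' Em'] := block_min_attained iA'.
have mm' : m = m' by apply: val_inj => /=; rewrite -Em -Em'.
by rewrite -(pblock_block AB mA) mm' (pblock_block A'B mA').
Qed.

Lemma eq_set_partition B C :
  (forall i j, (pblock B i == pblock B j) = (pblock C i == pblock C j)) ->
  B = C.
Proof.
have blockE (D : set_partition n) i j : (j \in pblock D i) = (pblock D i == pblock D j).
  by rewrite eq_pblock ?block_triv ?block_cover.
move=> BC; have E i : pblock B i = pblock C i.
  by apply/finset.setP => j; rewrite !blockE BC.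
apply: val_inj; apply/finset.setP => A /=.
apply/idP/idP => AD; have [i iA] := block_inhabited AD.
  by rewrite -(pblock_block AD iA) E -mem_blocks pblock_blocks.
by rewrite -(pblock_block AD iA) -E -mem_blocks pblock_blocks.
Qed.

Definition block_rank B i : nat := index (pblock B i) (blocks B).

Lemma eq_block_rank B i j :
  (block_rank B i == block_rank B j) = (pblock B i == pblock B j).
Proof.
rewrite /block_rank; apply/eqP/eqP => [E|->//].
by rewrite -(nth_index finset.set0 (pblock_blocks B i)) E nth_index ?pblock_blocks.
Qed.

(** The increments of [B] as a predicate: [i] opens a new block. *)
Definition leader B i : bool := tnth (increments B) i.

Lemma leaderE B i : leader B i = (block_min (pblock B i) == i :> nat).
Proof. by rewrite /leader tnth_mktuple eq_sym. Qed.

Definition minima B : seq nat := [seq block_min A | A <- blocks B].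

(** Blocks are listed by increasing minimum and distinct blocks have distinct
    minima, so the list of minima is the increasing list of the leaders, which
    the increments determine. *)
Lemma minima_increments B C : increments B = increments C ->
  minima B = minima C.
Proof.
move=> BC.
have minima_sorted D : sorted leq (minima D).
  by rewrite sorted_map; apply: sort_sorted => A A'; exact: leq_total.
have minima_uniq D : uniq (minima D).
  rewrite map_inj_in_uniq ?blocks_uniq// => A A'; rewrite !mem_blocks.
  exact: block_min_inj.
have mem_minima D (k : nat) :
    reflect (exists2 i, leader D i & k = i :> nat) (k \in minima D).
  apply: (iffP mapP) => [[A]|[i Di ->]].
    rewrite mem_blocks => AD ->; have [i iA] := block_inhabited AD.
    have [m mA Em] := block_min_attained iA.
    by exists m => //; rewrite leaderE (pblock_block AD mA) Em.
  by exists (pblock D i); [exact: pblock_blocks|apply/esym/eqP; rewrite -leaderE].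
apply: (sorted_eq leq_trans anti_leq) => //; apply: uniq_perm => // k.
by apply/mem_minima/mem_minima => -[i Di ->]; exists i => //; move: Di;
  rewrite /leader BC.
Qed.

(** Together with [minima_increments], this makes the rank of a leader a
    function of the increments alone. *)
Lemma block_rank_leader B i :
  leader B i -> block_rank B i = index (i : nat) (minima B).
Proof.
rewrite leaderE => /eqP mi; rewrite -[X in index X _]mi /block_rank /minima.
(* Minima are injective on the blocks of B only, so the induction on the list
   of blocks has to carry the inclusion memD. *)
have memD : {subset pblock B i :: blocks B <= block_set B}.
  by move=> A; rewrite inE => /orP[/eqP->|]; rewrite -mem_blocks ?pblock_blocks.
elim: (blocks B) memD => //= A s IHs memD.
have AB : A \in block_set B by apply: memD; rewrite !inE eqxx orbT.
have iB : pblock B i \in block_set B by apply: memD; rewrite !inE eqxx.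
rewrite (inj_in_eq (@block_min_inj B))// IHs// => A' A's.
by apply: memD; move: A's; rewrite !inE => /orP[->//|->]; rewrite !orbT.
Qed.

(** * Interval partitions are the heaviest *)

(** The first element [m] of the block of [i] is a leader, so its rank is the
    same in [B] and in [C]; since [m <= i], monotonicity of the ranks of [C]
    (that is, [C] consists of successive intervals) gives the bound. *)
Lemma block_rank_le_monotone B C : increments B = increments C ->
  (forall i j, i <= j -> block_rank C i <= block_rank C j) ->
  forall i, block_rank B i <= block_rank C i.
Proof.
move=> BC Cmono i; have [m mB Em] := block_min_attained (mem_own_block B i).
have Bim : pblock B m = pblock B i.
  by apply: pblock_block mB; rewrite -mem_blocks pblock_blocks.
have mlead : leader B m by rewrite leaderE Bim Em.
have -> : block_rank B i = block_rank C m.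
  rewrite /block_rank -Bim -/(block_rank B m) block_rank_leader//.
  by rewrite (minima_increments BC) -block_rank_leader// /leader -BC.
by apply: Cmono; rewrite -Em block_min_le// mem_own_block.
Qed.

Definition weight B : nat := \sum_i block_rank B i.

(** Equal weights would force equality in each of the inequalities of
    [block_rank_le_monotone], and the ranks of all elements determine the
    partition. *)
Lemma weight_lt_monotone B C : increments B = increments C ->
  (forall i j, i <= j -> block_rank C i <= block_rank C j) ->
  B != C -> weight B < weight C.
Proof.
move=> BC Cmono; have leBC := block_rank_le_monotone BC Cmono.
apply: contraNT; rewrite -leqNgt => CB; apply/eqP/eq_set_partition => i j.
suff E k : block_rank B k = block_rank C k by rewrite -!eq_block_rank !E.
have lef l : true -> block_rank B l <= block_rank C l ?= iff
    (block_rank B l == block_rank C l).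
  by move=> _; split; first exact: leBC.
have [_] := leqif_sum lef.
rewrite -/(weight B) -/(weight C) eqn_leq CB andbT.
have -> : weight B <= weight C by exact: leq_sum.
by move/esym/forallP/(_ k)/eqP.
Qed.

(** * Relabelling into an interval partition *)

Section Relabel.
Variables (s : {perm 'I_n}) (B : set_partition n).

Lemma relabel_subproof :
  finset.partition [set s @: (A : {set 'I_n}) | A in block_set B]%SET [set: 'I_n]%SET.
Proof.
have -> : [set: 'I_n]%SET = (s @: [set: 'I_n])%SET.
  apply/esym/finset.setP => i; rewrite finset.in_setT -[i](permKV s).
  exact: imset_f.
by rewrite imset_partition; [case: B|exact: perm_inj].
Qed.

Definition relabel : set_partition n := SetPartition relabel_subproof.

(** [s] moves each block entirely before the later ones, so that it turns the
    blocks into successive intervals. *)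
Hypothesis s_mono : forall i j, block_rank B i < block_rank B j -> s i < s j.

(** Relabelling commutes with the listing in order of appearance, because the
    images of consecutive blocks still have increasing minima. *)
Lemma blocks_relabel :
  blocks relabel = [seq (s @: (A : {set 'I_n}))%SET | A <- blocks B].
Proof.
have injs : injective (fun A : {set 'I_n} => (s @: A)%SET).
  exact: imset_inj perm_inj.
have perm_blocks : perm_eq (blocks relabel)
    [seq (s @: (A : {set 'I_n}))%SET | A <- blocks B].
  apply: uniq_perm; rewrite ?blocks_uniq ?map_inj_uniq ?blocks_uniq// => D.
  rewrite mem_blocks; apply/imsetP/mapP => -[A AB ->]; exists A => //;
    by move: AB; rewrite mem_blocks.
have relE A : A \in blocks relabel -> A \in block_set relabel.
  by rewrite mem_blocks.
apply: (sorted_eq_in (leT := fun A A1 : {set _} => block_min A <= block_min A1)) => //.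
- by move=> A1 A2 A3 _ _ _; exact: leq_trans.
- by move=> A1 A2 /relE A1B /relE A2B /anti_leq; exact: (block_min_inj A1B A2B).
- by apply: sort_sorted => A1 A2; exact: leq_total.
apply/(sortedP finset.set0) => k; rewrite size_map => ltk.
rewrite !(nth_map finset.set0) ?(ltnW ltk)//.
set A := nth _ _ k; set A' := nth _ _ k.+1.
have AB : A \in block_set B by rewrite -mem_blocks mem_nth// ltnW.
have A'B : A' \in block_set B by rewrite -mem_blocks mem_nth.
have [i iA] := block_inhabited AB; have [i' iA'] := block_inhabited A'B.
have [_ /imsetP[j jA ->] ->] := block_min_attained (imset_f s iA').
apply: leq_trans (block_min_le (imset_f s iA)) _; apply/ltnW/s_mono.
by rewrite /block_rank (pblock_block AB iA) (pblock_block A'B jA)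
  !index_uniq ?blocks_uniq// ltnW.
Qed.

Lemma block_sizes_relabel : block_sizes relabel = block_sizes B.
Proof.
apply: val_inj; rewrite /= blocks_relabel -map_comp; apply: eq_map => A /=.
by rewrite card_imset//; exact: perm_inj.
Qed.

Lemma block_rank_relabel i : block_rank relabel (s i) = block_rank B i.
Proof.
rewrite /block_rank blocks_relabel.
rewrite (@pblock_block relabel (s @: pblock B i)%SET); last 2 first.
- by apply: imset_f; rewrite -mem_blocks pblock_blocks.
- exact/imset_f/mem_own_block.
exact/index_map/imset_inj/perm_inj.
Qed.

Lemma weight_relabel : weight relabel = weight B.
Proof.
rewrite /weight (reindex_inj (@perm_inj _ s)).
by apply: eq_bigr => i _; exact: block_rank_relabel.
Qed.

Lemma relabel_monotone i j :
  i <= j -> block_rank relabel i <= block_rank relabel j.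
Proof.
rewrite -[i](permKV s) -[j](permKV s) !block_rank_relabel !permKV.
by move=> ij; rewrite leqNgt; apply/negP => /s_mono; rewrite !permKV ltnNge ij.
Qed.

End Relabel.

(** [s i] is the position of [i] in the list of all elements sorted by [r]. *)
Lemma sorting_perm (r : 'I_n -> nat) :
  exists s : {perm 'I_n}, forall i j, r i < r j -> s i < s j.
Proof.
pose L := sort (relpre r leq) (enum 'I_n).
have memL i : i \in L by rewrite mem_sort mem_enum.
have sizeL : size L = n by rewrite size_sort size_enum_ord.
have ltL i : index i L < n by rewrite -[X in _ < X]sizeL index_mem.
have injL : injective (fun i => Ordinal (ltL i)).
  by move=> i j [] E; rewrite -(nth_index i (memL i)) E nth_index.
exists (perm injL) => i j; rewrite !permE /=; apply: contraTT.
rewrite -!leqNgt => ij.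
rewrite -[i](nth_index i (memL i)) -[j in r j](nth_index i (memL j)).
apply: (sorted_leq_nth (leT := relpre r leq)); rewrite ?inE ?sizeL//.
- by move=> x y z; exact: leq_trans.
- by move=> x; exact: leqnn.
- by apply: sort_sorted => x y; exact: leq_total.
Qed.

(** * The triangular system *)

(** Given [B], the equation used is the one for the increments of the interval
    partition obtained from [B]: its other terms have smaller weight. *)
Lemma block_sizes_sum_inj (V : zmodType) (q : composition n -> V) :
  (forall x, \sum_(B | increments B == x) q (block_sizes B) = 0)%R ->
  forall B, q (block_sizes B) = 0%R.
Proof.
move=> q0 B; have [w] := ubnP (weight B); elim: w B => // w IHw B ltw.
have [s smono] := sorting_perm (block_rank B).
have := q0 (increments (relabel s B)).
rewrite (bigD1 (relabel s B))//= block_sizes_relabel// big1 ?addr0// => D.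
case/andP=> /eqP incD neqD; apply: IHw.
have := weight_lt_monotone incD (relabel_monotone smono) neqD.
by rewrite weight_relabel// => /leq_trans; apply.
Qed.

End BlockOrder.

(** * From sums to distributions *)

(** Tuples carry the sigma-algebra generated by the coordinates; a singleton
    is a finite intersection of coordinate preimages. *)
Lemma measurable_tuple_set1 (n : nat) (x : n.-tuple bool) :
  measurable [set x]%classic.
Proof.
have -> : ([set x] = \bigcap_(i in [set: 'I_n])
    (fun y : n.-tuple bool => tnth y i) @^-1` [set tnth x i])%classic.
  apply/seteqP; split => [y -> i //|y yx]; apply: eq_from_tnth => i.
  exact: (yx i).
apply: fin_bigcap_measurable => [|i _]; first exact: finite_finset.
by rewrite -[X in measurable X]setTI; apply: measurable_tnth.
Qed.

Lemma probability_sum (n : nat) (R : realType) (d : measure_display)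
    (T : measurableType d) (P : probability T R)
    (Pi : {RV P >-> set_partition n}) (A : {pred set_partition n}) :
  (P (Pi @^-1` [set` A])%classic =
   \sum_(B | B \in A) P (Pi @^-1` [set B])%classic)%E.
Proof.
have -> : (Pi @^-1` [set` A] = \bigcup_(B in [set` A]) Pi @^-1` [set B])%classic.
  by apply/seteqP; split => [t At|t [B AB /= ->]//]; exists (Pi t).
rewrite measure_fin_bigcup//=; first last.
- by move=> B _; rewrite -[X in measurable X]setTI; apply: measurable_funPT.
- by move=> B C _ _ [t [/= <- <-]].
rewrite (@fsbigE _ _ _ _ _ (enum A)) ?enum_uniq//.
- rewrite big_enum_cond /=; apply: eq_bigl => B.
  by rewrite mem_setE /= andbb.
- by move=> B; rewrite /= mem_enum.
- by move=> B /=; rewrite mem_enum => ->.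
Qed.

Theorem theorem1 (n : nat) (hn : (0 < n)%N) (R : realType)
    (d d' : measure_display)
    (T : measurableType d) (T' : measurableType d')
    (P : probability T R) (P' : probability T' R)
    (Pi : {RV P >-> set_partition n}) (Pi' : {RV P' >-> set_partition n}) :
  partially_exchangeable Pi -> partially_exchangeable Pi' ->
  same_distribution
    (increments (n := n) \o Pi : {RV P >-> n.-tuple bool})
    (increments (n := n) \o Pi' : {RV P' >-> n.-tuple bool}) ->
  same_distribution Pi Pi'.
Proof.
move=> [p Pp] [p' Pp'] incE.
have pE B : p (block_sizes B) = p' (block_sizes B).
  apply/eqP; rewrite -subr_eq0; apply/eqP.
  apply: (block_sizes_sum_inj (q := fun c => p c - p' c)%R) => x.
  have := incE [set x]%classic (measurable_tuple_set1 x).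
  rewrite /distribution /pushforward.
  have preE (U : Type) (f : U -> set_partition n) :
      ((increments (n := n) \o f) @^-1` [set x] =
       f @^-1` [set` [pred C | increments C == x]])%classic.
    by apply/seteqP; split => t /=; rewrite inE => /eqP.
  rewrite !preE !probability_sum (eq_bigr _ (fun C _ => Pp C)).
  rewrite (eq_bigr _ (fun C _ => Pp' C)) !sumEFin => -[] sumE.
  by rewrite sumrB; apply/eqP; rewrite subr_eq0; apply/eqP.
move=> A mA; rewrite /distribution /pushforward.
have -> : A = [set` mem A]%classic by apply/seteqP; split => B; rewrite /= inE.
rewrite !probability_sum; apply: eq_bigr => B _.
by rewrite Pp Pp' pE.
Qed.
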